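(* Let $G$ be a group and let $\delta_G$ be the discrete topology on $G$. Then $G$ is a Taĭmanov group if and only if both $Z(G)=\{e_G\}$ and $\delta_G$ is A$_{\mathcal H}$-complete, where $\mathcal H$ is the class of all Hausdorff topological groups.
   Context: A continuous group isomorphism $f:(G,\tau)\to(H,\sigma)$ of topological groups is semitopological if there exist a topological group $(\widetilde G,\widetilde\tau)$ containing $G$ as a normal subgroup with $\widetilde\tau$ inducing $\tau$ on $G$, and an open continuous homomorphism $\widetilde f:(\widetilde G,\widetilde\tau)\to(H,\sigma)$ extending $f$ (here topological groups are not assumed Hausdorff). A Hausdorff group topology $\tau$ on $G$ is A$_{\mathcal H}$-complete if for every Hausdorff group topology $\sigma\le\tau$ on $G$ such that $id_G:(G,\tau)\to(G,\sigma)$ is semitopological, one has $\sigma=\tau$. The Taĭmanov topology $T_G$ on a group $G$ is the group topology whose neighborhoods of $e_G$ have as a base the centralizers $c_G(F)$ of finite subsets $F\subseteq G$. The group $G$ is Taĭmanov if $T_G$ is the discrete topology (equivalently, some finite $F\subseteq G$ has $c_G(F)=\{e_G\}$). $Z(G)$ is the center of $G$. *)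

(* Defs.v *)
From HB Require Import structures.
From mathcomp Require Import all_boot.
From mathcomp Require Import all_classical topology.

Set Implicit Arguments.
Unset Strict Implicit.
Unset Printing Implicit Defensive.

Local Open Scope classical_set_scope.
Local Open Scope group_scope.

(* Several topologies on one carrier have to be compared, so a topology is a
   first-class family of open sets; [space tau] is the carrier seen as a
   [topologicalType]. *)
Record topology (T : Type) := Topology {
  opens : set_system T;
  opens_setT : opens setT;
  opens_setI : setI_closed opens;
  opens_bigcup : forall (I : Type) (f : I -> set T),
    (forall i, opens (f i)) -> opens (\bigcup_i f i) }.

Lemma topology_eq (T : Type) (s t : topology T) : opens s = opens t -> s = t.
Proof.
case: s t => [os sT sI sU] [ot tT tI tU] /= est; rewrite -{}est in tT tI tU *.
by congr Topology; exact: Prop_irrelevance.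
Qed.

Definition space (T : Type) (tau : topology T) : Type := T.

HB.instance Definition _ (T : choiceType) (tau : topology T) :=
  Choice.copy (space tau) T.
HB.instance Definition _ (T : choiceType) (tau : topology T) :=
  @isOpenTopological.Build (space tau) (opens tau)
    (opens_setT tau) (@opens_setI _ tau) (@opens_bigcup _ tau).

Lemma space_openE (T : choiceType) (tau : topology T) :
  @open (space tau) = opens tau.
Proof. by []. Qed.

Definition coarser (T : Type) (sigma tau : topology T) : Prop :=
  opens sigma `<=` opens tau.

Definition discrete (T : Type) : topology T :=
  @Topology T setT I (fun _ _ _ _ => I) (fun _ _ _ => I).

(* No separation axiom is assumed. *)
Definition group_topology (G : groupType) (tau : topology G) : Prop :=
  continuous ((fun p => (p.1 : G) * (p.2 : G)) :
    (space tau * space tau)%type -> space tau) /\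
  continuous ((fun x => (x : G)^-1) : space tau -> space tau).

Definition hausdorff_group_topology (G : groupType) (tau : topology G) : Prop :=
  group_topology tau /\ hausdorff_space (space tau).

(* "[Gt] contains [G] as a normal subgroup, [taut] inducing [tau] on [G]" is
   rendered by a monomorphism [i] with normal image that pulls [taut] back
   to [tau]. *)
Definition normal_topological_embedding (G Gt : groupType)
    (tau : topology G) (taut : topology Gt) (i : {multiplicative G -> Gt}) :
    Prop :=
  [/\ injective i,
      forall x g : Gt, range i x -> range i (x ^ g) &
      opens tau = [set i @^-1` V | V in opens taut]].

Definition semitopological (G H : groupType)
    (tau : topology G) (sigma : topology H) (f : {multiplicative G -> H}) :
    Prop :=
  [/\ group_topology tau, group_topology sigma, bijective f,
      continuous (f : space tau -> space sigma) &
      exists (Gt : groupType) (taut : topology Gt)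
             (i : {multiplicative G -> Gt}) (ft : {multiplicative Gt -> H}),
        [/\ group_topology taut,
            normal_topological_embedding tau taut i,
            continuous (ft : space taut -> space sigma),
            forall U, opens taut U -> opens sigma (ft @` U) &
            forall x, ft (i x) = f x]].

Definition A_complete (G : groupType) (tau : topology G) : Prop :=
  hausdorff_group_topology tau /\
  forall sigma : topology G,
    hausdorff_group_topology sigma -> coarser sigma tau ->
    semitopological tau sigma (idfun : {multiplicative G -> G}) ->
    sigma = tau.

Definition centralizer (G : groupType) (F : set G) : set G :=
  [set x | forall y, F y -> commute x y].

Definition center (G : groupType) : set G := centralizer [set: G].
Arguments center G : clear implicits.

Section TaimanovTopology.
Variable G : groupType.

Definition taimanov_open (U : set G) : Prop :=
  forall x, U x ->
    exists2 F, finite_set F & [set x * c | c in centralizer F] `<=` U.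

Lemma centralizerU (E F : set G) :
  centralizer (E `|` F) = centralizer E `&` centralizer F.
Proof.
apply/seteqP; split=> x => [cx|[cE cF] y [/cE|/cF]//].
by split=> y ?; apply: cx; [left|right].
Qed.

Lemma taimanov_openT : taimanov_open setT.
Proof. by move=> x _; exists set0. Qed.

Lemma taimanov_openI : setI_closed taimanov_open.
Proof.
move=> U V oU oV x [/oU[E fE EU] /oV[F fF FV]].
exists (E `|` F); first by rewrite finite_setU.
by rewrite centralizerU => _ [c [cE cF] <-]; split;
  [apply: EU; exists c|apply: FV; exists c].
Qed.

Lemma taimanov_open_bigcup (I : Type) (f : I -> set G) :
  (forall i, taimanov_open (f i)) -> taimanov_open (\bigcup_i f i).
Proof.
move=> of_ x [i _ /of_[F fF sF]]; exists F => //.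
by move=> y /sF; exists i.
Qed.

Definition taimanov_topology : topology G :=
  Topology taimanov_openT taimanov_openI taimanov_open_bigcup.

Lemma centralizer1 (F : set G) : centralizer F 1.
Proof. by move=> y _; rewrite /commute mul1g mulg1. Qed.

Lemma centralizerM (F : set G) x y :
  centralizer F x -> centralizer F y -> centralizer F (x * y).
Proof.
move=> cx cy z Fz; apply: commute_sym; apply: commuteM; apply: commute_sym.
  exact: cx.
exact: cy.
Qed.

Lemma centralizerV (F : set G) x : centralizer F x -> centralizer F x^-1.
Proof.
by move=> cx z Fz; apply/commute_sym/commuteV/commute_sym/cx.
Qed.

Lemma taimanov_nbhsE (x : G) :
  @nbhs _ (space taimanov_topology) x =
  filter_from finite_set (fun F => [set x * c | c in centralizer F]).
Proof.
apply/seteqP; split=> A.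
  by case=> B [oB Bx sBA]; have [F fF sF] := oB _ Bx; exists F => // y /sF/sBA.
case=> F fF sFA; exists [set x * c | c in centralizer F]; split => //.
  move=> _ [c cF <-]; exists F => // _ [d dF <-].
  by exists (c * d); [exact: centralizerM|rewrite mulgA].
by exists 1; [exact: centralizer1|rewrite mulg1].
Qed.

Lemma taimanov_nbhs1E :
  @nbhs _ (space taimanov_topology) (1 : G) =
  filter_from finite_set (@centralizer G).
Proof.
rewrite taimanov_nbhsE; congr filter_from; apply/funext => F.
apply/seteqP; split=> [_ [c cF <-]|c cF]; first by rewrite mul1g.
by exists c; rewrite ?mul1g.
Qed.

Lemma centralizer_conj (F : set G) (g c : G) :
  centralizer [set z ^ g^-1 | z in F] c -> centralizer F (c ^ g).
Proof.
move=> cF z Fz; have /cF cz : [set z ^ g^-1 | z in F] (z ^ g^-1) by exists z.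
by rewrite /commute -{1 2}[z](conjgKV g) -!conjMg cz.
Qed.

Lemma taimanov_group_topology : group_topology taimanov_topology.
Proof.
split=> [[x y]|x] A; rewrite /= !taimanov_nbhsE.
  case=> F fF sFA.
  exists ([set x * c | c in centralizer [set z ^ y^-1 | z in F]],
          [set y * c | c in centralizer F]).
    split; rewrite /= taimanov_nbhsE; last by exists F.
    by exists [set z ^ y^-1 | z in F] => //; exact: finite_image.
  move=> [_ _] /= [[c cF <-] [d dF <-]]; apply: sFA.
  exists (c ^ y * d); first by apply: centralizerM => //; exact: centralizer_conj.
  by rewrite conjgE !mulgA mulgK.
case=> F fF sFA; exists [set z ^ x | z in F]; first exact: finite_image.
move=> _ [c cF <-]; apply: sFA; exists (c^-1 ^ x^-1).
  apply: centralizer_conj; rewrite invgK; exact: centralizerV.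
by rewrite conjgE invgK !mulgA mulVg mul1g invgM.
Qed.

End TaimanovTopology.

Definition taimanov (G : groupType) : Prop :=
  taimanov_topology G = discrete G.

(* Main.v *)
(* A group topology [sigma] makes [id : (G, delta_G) -> (G, sigma)]
   semitopological if and only if [T_G <= sigma]; with [Z(G)] trivial, [T_G] is
   itself Hausdorff, so completeness of [delta_G] says that [T_G] is discrete.
   If [Gt] witnesses semitopologicity, then for [x] near [1] the commutator
   [[~ x, g]] lies in the discrete normal subgroup [G], hence is [1], so that
   the image of a neighborhood of [1] lies in the centralizer of [g].
   Conversely, take the semidirect product of [G], acting on a discrete copy
   of itself by conjugation, with acting group [(G, sigma)]; the isomorphism
   [(a, b) |-> (a * b, b)] turns it into [G * G], the neighborhoods of [1] into
   diagonals [{(c, c) | c in V}], and the extension of [id] into [fst]. *)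
From HB Require Import structures.
Require Import Defs.
From mathcomp Require Import all_boot.
From mathcomp Require Import all_classical topology.

Set Implicit Arguments.
Unset Strict Implicit.
Unset Printing Implicit Defensive.

Local Open Scope classical_set_scope.
Local Open Scope group_scope.

Lemma discrete_nbhsE (T : choiceType) (x : T) (A : set T) :
  @nbhs _ (space (discrete T)) x A <-> A x.
Proof.
split=> [/nbhs_singleton //|Ax]; exists A; split=> //.
Qed.

Lemma discrete_group_topology (G : groupType) : group_topology (discrete G).
Proof.
split=> [[x y]|x] A /discrete_nbhsE Ax; last exact/discrete_nbhsE.
exists ([set x], [set y]); first by split; exact/discrete_nbhsE.
by move=> [_ _] [/= -> ->].
Qed.

Lemma discrete_hausdorff (T : choiceType) :
  hausdorff_space (space (discrete T)).
Proof.
move=> p q /(_ [set p] [set q]) []; try exact/discrete_nbhsE.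
by move=> _ [-> ->].
Qed.

(* Filter lemmas phrased at [space tau]: their [Filter] argument is not
   inferred when the point is only known to have type [T]. *)
Lemma space_nbhsS (T : choiceType) (tau : topology T) (x : T) (A B : set T) :
  A `<=` B -> @nbhs _ (space tau) x A -> @nbhs _ (space tau) x B.
Proof. exact: (@filterS _ (nbhs (x : space tau))). Qed.

Lemma space_nbhsI (T : choiceType) (tau : topology T) (x : T) (A B : set T) :
  @nbhs _ (space tau) x A -> @nbhs _ (space tau) x B ->
  @nbhs _ (space tau) x (A `&` B).
Proof. exact: (@filterI _ (nbhs (x : space tau))). Qed.

Section GroupTopology.
Variables (G : groupType) (sigma : topology G).
Hypothesis sigmaG : group_topology sigma.

Lemma cvg_mulg (T : Type) (F : set_system T) (f g : T -> space sigma)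
    (x y : space sigma) {FF : Filter F} :
  f @ F --> x -> g @ F --> y ->
  (fun t => (f t : G) * (g t : G) : space sigma) @ F -->
    ((x : G) * (y : G) : space sigma).
Proof.
move=> fx gy.
exact: (cvg_comp (fun t => (f t, g t)) _ (cvg_pair fx gy) (sigmaG.1 (x, y))).
Qed.

Lemma nbhs_mulgl (x y : G) (A : set G) :
  @nbhs _ (space sigma) (x * y) A <->
  @nbhs _ (space sigma) y [set c | A (x * c)].
Proof.
have mulx (z t : G) : (fun c : space sigma => z * (c : G) : space sigma)
    @ (t : space sigma) --> (z * t : space sigma).
  by apply: (@cvg_mulg _ (nbhs (t : space sigma)) (fun=> z) id);
    [exact: cvg_cst|exact: cvg_id].
split=> [/(mulx x y)//|nA].
have := mulx x^-1 (x * y); rewrite mulKg => /(_ _ nA) /=.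
by apply: space_nbhsS => c /=; rewrite mulVKg.
Qed.

Lemma cvg_conjg1 (x : G) :
  (fun c : space sigma => (c : G) ^ x : space sigma) @ (1 : space sigma) -->
    (1 : space sigma).
Proof.
rewrite -[X in _ --> X](conj1g x).
apply: (@cvg_mulg _ (nbhs (1 : space sigma)) (fun=> x^-1)).
  exact: cvg_cst.
by apply: (@cvg_mulg _ (nbhs (1 : space sigma)) id (fun=> x));
  [exact: cvg_id|exact: cvg_cst].
Qed.

(** Left translations are homeomorphisms, so openness at [x] can be tested at the identity. *)
Lemma opens_nbhs1 (U : set G) :
  (forall x, U x -> @nbhs _ (space sigma) 1 [set c | U (x * c)]) <->
  opens sigma U.
Proof.
rewrite -space_openE openE; split=> oU x Ux; have := oU x Ux.
  by rewrite -(nbhs_mulgl x 1) mulg1.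
by rewrite -{1}[x in _^° x]mulg1 /interior /= => /(nbhs_mulgl x 1).
Qed.

(** Each [commute g] is the centralizer of a single element, hence [T_G]-open; conversely a basic
    [centralizer F] is a finite intersection of such sets. *)
Lemma coarser_taimanovE :
  coarser (taimanov_topology G) sigma <->
  forall g : G, @nbhs _ (space sigma) 1 (commute g).
Proof.
split=> [cs g|cs U oU].
  suff oC : opens sigma (commute g).
    by exists (commute g); split=> //; exact: commute1.
  apply: cs => x gx; exists [set g] => // _ [c cg <-].
  by apply: commuteM => //; apply/commute_sym/cg.
apply/opens_nbhs1 => x /oU[F fF sF].
have : @nbhs _ (space sigma) 1 (\bigcap_(g in F) commute g).
  by have /finite_fsetP[D ->] := fF; apply: filter_bigI.
apply: filterS => c cF; apply: sF; exists c => // g Fg.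
exact/commute_sym/cF.
Qed.

End GroupTopology.

Section DiagonalTopology.
Variables (G : groupType) (sigma : topology G).

Let translate (p : G * G) (c : G) : G * G := (p.1 * c, p.2 * c).

(** Basic neighborhoods of [p] are meant to be [p] times a diagonal. In this form the axioms of a
    topology use only that the neighborhoods of 1 are a filter. *)
Definition diagonal_open (U : set (G * G)) : Prop :=
  forall p, U p -> @nbhs _ (space sigma) 1 (translate p @^-1` U).

Lemma diagonal_openT : diagonal_open setT.
Proof. by move=> p _; exact: (@filterT _ (nbhs (1 : space sigma))). Qed.

Lemma diagonal_openI : setI_closed diagonal_open.
Proof.
move=> U V oU oV p [/oU nU /oV nV].
exact: space_nbhsI.
Qed.

Lemma diagonal_open_bigcup (I : Type) (f : I -> set (G * G)) :
  (forall i, diagonal_open (f i)) -> diagonal_open (\bigcup_i f i).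
Proof.
move=> of_ p [i _ /of_]; apply: space_nbhsS.
by move=> c fic; exists i.
Qed.

Definition diagonal_topology : topology (G * G) :=
  Topology diagonal_openT diagonal_openI diagonal_open_bigcup.

Hypothesis sigmaG : group_topology sigma.

Lemma diagonal_nbhsE (p : G * G) (A : set (G * G)) :
  @nbhs _ (space diagonal_topology) p A <->
  @nbhs _ (space sigma) 1 (translate p @^-1` A).
Proof.
split=> [[B [oB Bp sBA]]|nA].
  by apply: space_nbhsS (oB p Bp) => c /sBA.
(* The expected interior of [A]; it is open because the interior of a [sigma]-neighborhood of 1 is
   again one. *)
exists [set q | @nbhs _ (space sigma) 1 (translate q @^-1` A)]; split=> //.
  move=> q /nbhs_interior; apply: space_nbhsS => d.
  rewrite /interior /= -{1}[d]mulg1 => /(nbhs_mulgl sigmaG).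
  apply: space_nbhsS => c.
  by rewrite /translate /= !mulgA.
by move=> [x y] /nbhs_singleton; rewrite /translate /= !mulg1.
Qed.

Hypothesis sigmaC : forall g : G, @nbhs _ (space sigma) 1 (commute g).

(** Moving [(c, c)] to the right past [(x', y')] turns it into [(c ^ x', c ^ y')], which stays
    diagonal when [c] commutes with [x' * y'^-1]; [sigmaC] grants this for [c] near 1. For inverses
    the relevant element is [y^-1 * x]. *)
Lemma diagonal_group_topology :
  @group_topology (G * G)%type diagonal_topology.
Proof.
split=> [[[x y] [x' y']]|[x y]] A /diagonal_nbhsE nA.
  have [|[C D] [/= nC nD] sCD] :=
      sigmaG.1 (1, 1) (translate (x * x', y * y') @^-1` A).
    by rewrite /= mulg1.
  exists ([set p | exists2 c, commute (x' * y'^-1) c /\ C (c ^ x') &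
                              p = translate (x, y) c],
          [set p | exists2 d, D d & p = translate (x', y') d]).
    split; apply/diagonal_nbhsE => /=.
      have := space_nbhsI (sigmaC (x' * y'^-1)) (cvg_conjg1 sigmaG x' nC).
      by apply: space_nbhsS => c [cc Cc]; exists c.
    by apply: space_nbhsS nD => d Dd; exists d.
  move=> [_ _] /= [[c [cc Cc] ->] [d Dd ->]].
  have := sCD (c ^ x', d) (conj Cc Dd); rewrite /translate /=.
  congr (A (_, _)); first by rewrite conjgE !mulgA mulgK.
  have -> : c ^ x' = c ^ y'.
    rewrite -[x'](mulgVK y') conjgM; congr (_ ^ y').
    by rewrite conjgE -cc mulKg.
  by rewrite conjgE !mulgA mulgK.
apply/diagonal_nbhsE.
have nV := sigmaG.2 1; rewrite /continuous_at invg1 in nV.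
have := space_nbhsI (sigmaC (y^-1 * x)) (nV _ (cvg_conjg1 sigmaG x^-1 nA)).
apply: space_nbhsS => c [cc]; rewrite /translate /=; congr (A (_, _)).
  by rewrite conjgE invgK !mulgA mulVg mul1g invgM.
rewrite conjgE invgK invgM !mulgA.
by rewrite (commuteV cc) !mulgA mulgK.
Qed.

End DiagonalTopology.

Lemma multiplicative1 (G H : groupType) (f : {multiplicative G -> H}) : f 1 = 1.
Proof. by apply: (mulgI (f 1)); rewrite -gmulfM !mulg1. Qed.

Lemma multiplicativeV (G H : groupType) (f : {multiplicative G -> H}) (x : G) :
  f x^-1 = (f x)^-1.
Proof. by apply: (mulgI (f x)); rewrite -gmulfM !mulgV multiplicative1. Qed.

Section FirstFactor.
Variable G : groupType.

(** The normal copy of [G] in the semidirect product, in the coordinates [(a * b, b)]. *)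
Definition first_factor (a : G) : G * G := (a, 1).

Lemma first_factor_multiplicative : {morph first_factor : x y / x * y}.
Proof. by move=> x y; congr pair; rewrite mulg1. Qed.

HB.instance Definition _ := isMultiplicative.Build G (G * G)%type
  first_factor first_factor_multiplicative.

End FirstFactor.

(** If [p] and [q] cannot be separated, their cosets of the centralizer of any [g] meet, so
    [p^-1 * q] commutes with every [g]. *)
Lemma taimanov_hausdorff (G : groupType) :
  center G = [set 1] -> hausdorff_space (space (taimanov_topology G)).
Proof.
move=> Z1 p q pq; have Zpq : center G ((p : G)^-1 * (q : G)).
  move=> g _; have nC (x : G) : @nbhs _ (space (taimanov_topology G)) x
      [set x * c | c in centralizer [set g]].
    by rewrite taimanov_nbhsE; exists [set g].
  have [_ [[c cg <-] [d dg /(canRL (mulgK _)) ->]]] := pq _ _ (nC p) (nC q).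
  by rewrite !mulgA mulVg mul1g; apply: (centralizerM cg (centralizerV dg)).
by move: Zpq; rewrite Z1 => /= /(canRL (mulVKg _)); rewrite mulg1.
Qed.

Lemma semitopological_discreteE (G : groupType) (sigma : topology G) :
  group_topology sigma ->
  semitopological (discrete G) sigma (idfun : {multiplicative G -> G}) <->
  coarser (taimanov_topology G) sigma.
Proof.
move=> sigmaG; rewrite coarser_taimanovE //; split.
  case=> _ _ _ _ [Gt [taut [i [ft [tautG emb _ ft_open fti]]]]] g.
  have [i_inj i_normal tau_i] := emb.
  have [V oV V1] : exists2 V, opens taut V & i @^-1` V = [set 1].
    by have : opens (discrete G) [set 1] by []; rewrite tau_i.
  have nV : @nbhs _ (space taut) 1 V.
    exists V; split=> //.
    by rewrite -(multiplicative1 i); suff : (i @^-1` V) 1 by []; rewrite V1.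
  pose W : set Gt := [set x | V [~ x, i g]].
  have nW : @nbhs _ (space taut) 1 W.
    (* The commutator is [x^-1 * x ^ (i g)], and both factors tend to 1 with [x]. *)
    apply: (cvg_mulg tautG (f := fun x : space taut => (x : Gt)^-1)
      (x := 1^-1) (y := 1) (F := nbhs (1 : space taut))).
      exact: (tautG.2 1).
      exact: cvg_conjg1.
    by rewrite invg1 mulg1.
  have [B [oB B1 sBW]] := nW.
  exists (ft @` B); split; first exact: ft_open.
    by exists 1; rewrite ?multiplicative1.
  move=> _ [x /sBW Wx <-].
  (* Read instead as [(i g)^-1 ^ x * i g], the commutator lies in the normal image of [i]. *)
  have [h _ ih] : range i [~ x, i g].
    have [h _ ih] : range i ((i g)^-1 ^ x).
      by apply: i_normal; exists g^-1; rewrite // multiplicativeV.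
    by exists (h * g); rewrite // gmulfM ih commgEr.
  have : (i @^-1` V) h by rewrite /= ih.
  rewrite V1 => h1; move: ih; rewrite h1 multiplicative1.
  move=> /esym/eqP/commgP xg; rewrite /commute -[g in LHS]fti -[g in RHS]fti.
  by rewrite -!gmulfM xg.
move=> sigmaC; split=> //.
- exact: discrete_group_topology.
- by move=> x A /nbhs_singleton Ax; apply/discrete_nbhsE.
exists (G * G)%type, (diagonal_topology sigma), (@first_factor G), fst.
split=> //.
- exact: diagonal_group_topology.
- split=> [x y [] //|_ [a b] [c _ <-]|].
    by exists (c ^ a) => //; congr pair; rewrite /= mul1g mulVg.
  apply/seteqP; split=> // A _.
  (* The map [(x, y) |-> x * y^-1] is constant on diagonal translates and sends [(a, 1)] to [a], so
     its preimage of [A] is open and induces [A]. *)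
  exists [set p | A (p.1 * p.2^-1)]; last first.
    by apply/funext => x /=; rewrite invg1 mulg1.
  move=> [x y] /= Axy; apply: (@filterE _ (nbhs (1 : space sigma))) => c /=.
  by rewrite invgM !mulgA mulgK.
- move=> [x y] A /=; rewrite -{1}[x]mulg1 => /(nbhs_mulgl sigmaG).
  by move=> nA; apply/diagonal_nbhsE.
move=> U oU; apply/(opens_nbhs1 sigmaG) => _ [[x y] Uxy <-].
apply: space_nbhsS (oU _ Uxy) => c Uc.
by exists (x * c, y * c).
Qed.

Theorem corollary6p6 (G : groupType) :
  taimanov G <-> center G = [set 1%g]%classic /\ A_complete (discrete G).
Proof.
split=> [TG|[Z1 [_ complete]]].
  split.
    apply/seteqP; split=> [z Zz|_ ->]; last exact: centralizer1.
    (* Discreteness yields a finite [F] with trivial centralizer, and the center lies in that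
       centralizer. *)
    have : @nbhs _ (space (taimanov_topology G)) 1 [set 1].
      by rewrite TG; apply/discrete_nbhsE.
    by rewrite taimanov_nbhs1E => -[F _]; apply=> g _; exact: Zz.
  split; first by split;
    [exact: discrete_group_topology|exact: discrete_hausdorff].
  move=> sigma [sigmaG _] s_le /semitopological_discreteE -/(_ sigmaG).
  rewrite TG => d_le; apply/topology_eq/seteqP; split; first exact: s_le.
  exact: d_le.
(* Completeness is tested on [sigma := taimanov_topology G]. *)
apply: complete.
- by split; [exact: taimanov_group_topology|exact: taimanov_hausdorff].
- by [].
- by apply/semitopological_discreteE; [exact: taimanov_group_topology|].
Qed.
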